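(* Let $m\ge 3$ and let $\chi$ be a primitive Dirichlet character modulo $2^m$. Let $q\ge 1$ be odd and $n\ge 1$. If $k\ge 0$ is an integer with $\chi(-1)\neq(-1)^k$, then $$\mathcal{L}_{k+2^n q,\chi}-\mathcal{L}_{k,\chi}\equiv \frac{2^{n+2}}{1-\bar\chi(5)}\cdot \mathcal{L}_{d,\chi}\pmod{2^{n+3}},$$ where $d\in\{0,1\}$ is such that $k\equiv d\pmod 2$. In particular, for integers $k,l\ge 0$ with $\chi(-1)\ne(-1)^k$ and $\chi(-1)\ne(-1)^l$, we have $\mathcal{L}_{k,\chi}\equiv\mathcal{L}_{l,\chi}\pmod{2^{n+2}}$ if and only if $k\equiv l\pmod{2^n}$.
   Context: For a Dirichlet character $\chi$, $L(s,\chi)=\sum_{n\ge1}\chi(n)n^{-s}$ (analytically continued); for integers $k\ge 0$ one has $L(-k,\chi)=-B_{k+1,\chi}/(k+1)$, where the generalized Bernoulli numbers for $\chi$ modulo $f$ are given by $\sum_{k\ge0}B_{k,\chi}t^k/k!=\sum_{a=1}^{f}\chi(a)\,te^{at}/(e^{ft}-1)$. ''$k$ has the opposite parity as $\chi$'' means $\chi(-1)\ne(-1)^k$. For $\chi$ of conductor $2^m$ with $m\ge3$, define $\mathcal{L}_{k,\chi}=(1-\chi(5))L(-k,\chi)$. $\bar\chi$ denotes the complex conjugate character. All quantities lie in the cyclotomic field generated by the values of $\chi$; a congruence $x\equiv y\pmod{2^r}$ means $(x-y)/2^r$ is integral at every prime above $2$ (i.e. lies in the localization of the ring of algebraic integers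 at the primes above $2$). *)

(* Defs.v *)
From mathcomp Require Import all_boot all_order all_algebra all_field.
Set Implicit Arguments. Unset Strict Implicit. Unset Printing Implicit Defensive.
Import Order.TTheory GRing.Theory Num.Theory.
Local Open Scope ring_scope.

Definition dirichlet_char (N : nat) (chi : int -> algC) : Prop :=
  [/\ (0 < N)%N,
      chi 1 = 1,
      forall a b : int, chi (a * b) = chi a * chi b,
      forall a : int, chi (a + N%:Z) = chi a &
      forall a : int, (chi a == 0) = ~~ coprimez a N%:Z].

Definition primitive_dchar (N : nat) (chi : int -> algC) : Prop :=
  dirichlet_char N chi /\
  forall d : nat, (d %| N)%N -> (d < N)%N ->
    exists a : int, [/\ coprimez a N%:Z, (a == 1 %[mod d%:Z])%Z & chi a != 1].

(* Generalized Bernoulli numbers of chi modulo f, from the generating function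
   sum_k B_{k,chi} t^k/k! = sum_{a=1}^f chi(a) t e^{at} / (e^{ft} - 1).
   Writing c_k = B_{k,chi}/k!, comparing coefficients of t^(n+1) in
   (sum_k c_k t^k) * (e^{ft} - 1) = sum_{a=1}^f chi(a) t e^{at} gives
   sum_{k<=n} c_k f^(n+1-k)/(n+1-k)! = sum_{a=1}^f chi(a) a^n / n!,
   which determines c_n recursively. *)
Definition gb_rhs (f : nat) (chi : int -> algC) (n : nat) : algC :=
  \sum_(1 <= a < f.+1) chi a%:Z * (a%:R) ^+ n / (n`!)%:R.

Fixpoint gb_coefs (f : nat) (chi : int -> algC) (n : nat) : seq algC :=
  match n with
  | 0 => [::]
  | n'.+1 =>
      let s := gb_coefs f chi n' in
      rcons s ((gb_rhs f chi n'
                - \sum_(k < n') s`_k * (f%:R) ^+ (n'.+1 - k) / ((n'.+1 - k)`!)%:R)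
               / f%:R)
  end.

Definition gen_bernoulli (f : nat) (chi : int -> algC) (k : nat) : algC :=
  (k`!)%:R * (gb_coefs f chi k.+1)`_k.

(* L(-k, chi) = - B_{k+1,chi} / (k+1) *)
Definition Lneg (f : nat) (chi : int -> algC) (k : nat) : algC :=
  - gen_bernoulli f chi k.+1 / (k.+1)%:R.

Definition calL (f : nat) (chi : int -> algC) (k : nat) : algC :=
  (1 - chi 5) * Lneg f chi k.

(* z is integral at every prime above 2: z = alpha / s, alpha an algebraic
   integer and s an odd rational integer. *)
Definition two_integral (z : algC) : Prop :=
  exists s : nat, odd s /\ (s%:R * z) \in Aint.

Definition cong2 (x y : algC) (r : nat) : Prop :=
  two_integral ((x - y) / 2%:R ^+ r).

(* Main.v *)
(* Write zeta = chi(5), varpi = 1 - zeta, u_k = 1 - zeta 5^(k+1).  Faulhaber-type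
   formulas give L(-k, chi) = - lim (1/((k+1)F)) sum_{a <= F} chi(a) a^(k+1) along F = 2^N,
   2-adically.  Comparing the sum with its image under a -> 5a gives
   u_k L(-k, chi) = lim sum_{a < F} floor(5a/F) chi(5a) (5a)^k, and pairing a with F - a
   turns this into 2 h_k, with h_k the limit of a sum over odd a < F/2.  As
   y^(2^n) = 1 mod 2^(n+2) for odd y, h_{k + 2^n q} = h_k mod 2^(n+2); modulo the prime
   varpi every odd residue contributes through its floor only, and a count gives
   h_k = 1 mod varpi.  Since v_k = varpi / u_k is 1 modulo 2 and calL_k = 2 h_k v_k, the
   difference of two values of calL comes from
   u_k - u_{k + 2^n q} = zeta 5^(k+1) 2^(n+2) (odd), and both sides of the congruence are
   2^(n+3) / varpi modulo 2^(n+3).  The equivalence follows because varpi divides 2 but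
   is not a unit at 2. *)
Require Import Defs.
From mathcomp Require Import all_boot all_order all_algebra all_field.
From mathcomp Require Import ring zify.
Import Order.TTheory GRing.Theory Num.Theory.
Local Open Scope ring_scope.

(** * Integrality and congruences at the primes above 2 *)

Lemma two_integral_Aint (z : algC) : z \in Aint -> two_integral z.
Proof. by exists 1%N; rewrite mul1r. Qed.

Lemma two_integral_nat (n : nat) : two_integral n%:R.
Proof. exact/two_integral_Aint/rpred_nat. Qed.

Lemma two_integralD (x y : algC) :
  two_integral x -> two_integral y -> two_integral (x + y).
Proof.
move=> [s [os xA]] [t [ot yA]]; exists (s * t)%N; rewrite oddM os; split=> //.
have -> : (s * t)%:R * (x + y) = t%:R * (s%:R * x) + s%:R * (t%:R * y).
  by rewrite natrM; ring.
by rewrite rpredD // rpredM // rpred_nat.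
Qed.

Lemma two_integralM (x y : algC) :
  two_integral x -> two_integral y -> two_integral (x * y).
Proof.
move=> [s [os xA]] [t [ot yA]]; exists (s * t)%N; rewrite oddM os; split=> //.
by rewrite natrM mulrACA rpredM.
Qed.

Lemma two_integralN (x : algC) : two_integral x -> two_integral (- x).
Proof. by move=> [s [os xA]]; exists s; rewrite mulrN rpredN. Qed.

Lemma two_integralB (x y : algC) :
  two_integral x -> two_integral y -> two_integral (x - y).
Proof. by move=> hx hy; apply/two_integralD/two_integralN. Qed.

Lemma two_integralX (x : algC) (k : nat) :
  two_integral x -> two_integral (x ^+ k).
Proof.
move=> hx; elim: k => [|k IH]; first exact: (two_integral_nat 1).
by rewrite exprS; apply: two_integralM.
Qed.

Lemma two_integral_sum (I : Type) (r : seq I) (P : pred I) (F : I -> algC) :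
  (forall i, P i -> two_integral (F i)) -> two_integral (\sum_(i <- r | P i) F i).
Proof.
move=> hF; apply: (big_ind two_integral) => //; first exact: (two_integral_nat 0).
exact: two_integralD.
Qed.

Lemma two_integral_oddV (s : nat) : odd s -> two_integral s%:R^-1.
Proof.
move=> os; exists s; split=> //; rewrite divff ?rpred1 // pnatr_eq0.
by case: s os.
Qed.

(** A rational algebraic integer lies in Z, and s/2 with s odd does not. The non-integrality of
    1/varpi is reduced to this. *)
Lemma two_integral_half : ~ two_integral 2%:R^-1.
Proof.
move=> [s [os]] hA.
have rA : (s%:R / 2%:R : algC) \in Crat by rewrite rpred_div ?rpred_nat.
have /intrP[z hz] := Cint_rat_Aint rA hA.
have : (s%:R : algC) = (2%:Z * z)%:~R.
  by rewrite intrM -hz mulrC divfK // pnatr_eq0.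
move/eqP; rewrite pmulrn eqr_int => /eqP; move: os; lia.
Qed.

(** The modulus is any algebraic number, since varpi serves as well as powers of 2; for
    [w = 2%:R ^+ r] this is [cong2]. Division by zero makes the relation trivial at [w = 0]. *)
Definition cmod (w x y : algC) : Prop := two_integral ((x - y) / w).

Lemma cmod_refl (w x : algC) : cmod w x x.
Proof. by rewrite /cmod subrr mul0r; apply: (two_integral_nat 0). Qed.

Lemma cmod_sym (w x y : algC) : cmod w x y -> cmod w y x.
Proof. by rewrite /cmod -[y - x]opprB mulNr => /two_integralN. Qed.

Lemma cmod_trans (w y x z : algC) : cmod w x y -> cmod w y z -> cmod w x z.
Proof.
move=> h1 h2; move: (two_integralD _ _ h1 h2).
by rewrite -mulrDl addrA subrK.
Qed.

Lemma cmodD (w x x' y y' : algC) :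
  cmod w x x' -> cmod w y y' -> cmod w (x + y) (x' + y').
Proof.
move=> h1 h2; move: (two_integralD _ _ h1 h2).
by rewrite -mulrDl /cmod opprD addrACA.
Qed.

Lemma cmodM (w x x' y y' : algC) : two_integral x -> two_integral y' ->
  cmod w x x' -> cmod w y y' -> cmod w (x * y) (x' * y').
Proof.
move=> hx hy h1 h2.
have := two_integralD _ _ (two_integralM _ _ hx h2) (two_integralM _ _ hy h1).
by rewrite /cmod; congr two_integral; ring.
Qed.

Lemma cmod_sum (w : algC) (I : Type) (r : seq I) (P : pred I) (F G : I -> algC) :
  (forall i, P i -> cmod w (F i) (G i)) ->
  cmod w (\sum_(i <- r | P i) F i) (\sum_(i <- r | P i) G i).
Proof.
move=> h; rewrite /cmod -sumrB mulr_suml; exact: two_integral_sum.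
Qed.

Lemma cmod_dvd (v w x y : algC) : two_integral (w / v) -> w != 0 ->
  cmod w x y -> cmod v x y.
Proof.
move=> hv w0 hw; move: (two_integralM _ _ hw hv).
by rewrite mulrA divfK.
Qed.

Lemma two_unit : (2%:R : algC) != 0. Proof. by rewrite pnatr_eq0. Qed.

Lemma cmod_le (r s : nat) (x y : algC) : (r <= s)%N ->
  cmod (2%:R ^+ s) x y -> cmod (2%:R ^+ r) x y.
Proof.
move=> le; apply: cmod_dvd; last by rewrite expf_neq0 // two_unit.
rewrite -(subnK le) exprD mulfK ?expf_neq0 ?two_unit // -natrX.
exact: two_integral_nat.
Qed.

(** * Bounded powers of 2 in denominators *)

Lemma two_integral_bounded_nat (n : nat) : (0 < n)%N ->
  exists e, two_integral (2%:R ^+ e * n%:R^-1).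
Proof.
move=> n0; have [e o nE] := pfactor_coprime (isT : prime 2) n0.
rewrite coprime2n in o; exists (logn 2 n); rewrite {2}nE natrM natrX invfM mulrC -mulrA.
rewrite mulVf ?expf_neq0 ?two_unit // mulr1; exact: two_integral_oddV.
Qed.

Definition two_bounded (z : algC) := exists e, two_integral (2%:R ^+ e * z).

Lemma two_boundedI (z : algC) : two_integral z -> two_bounded z.
Proof. by exists 0%N; rewrite mul1r. Qed.

Lemma two_boundedM (x y : algC) :
  two_bounded x -> two_bounded y -> two_bounded (x * y).
Proof.
move=> [d hx] [e hy]; exists (d + e)%N; rewrite exprD mulrACA.
exact: two_integralM.
Qed.

Lemma two_boundedD (x y : algC) :
  two_bounded x -> two_bounded y -> two_bounded (x + y).
Proof.
move=> [d hx] [e hy]; exists (d + e)%N.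
have -> : 2%:R ^+ (d + e) * (x + y)
  = (2 ^ e)%:R * (2%:R ^+ d * x) + (2 ^ d)%:R * (2%:R ^+ e * y).
  by rewrite !natrX exprD; ring.
by apply: two_integralD; apply: two_integralM => //; apply: two_integral_nat.
Qed.

Lemma two_boundedV (n : nat) : two_bounded n%:R^-1.
Proof.
case: n => [|n]; last exact: two_integral_bounded_nat.
by rewrite invr0; apply: two_boundedI; apply: (two_integral_nat 0).
Qed.

Lemma two_bounded_sum (I : Type) (r : seq I) (P : pred I) (F : I -> algC) :
  (forall i, P i -> two_bounded (F i)) -> two_bounded (\sum_(i <- r | P i) F i).
Proof.
move=> hF; apply: (big_ind two_bounded) => //; last exact: two_boundedD.
exact: two_boundedI (two_integral_nat 0).
Qed.

(** One exponent e serves all F, so F times the value at F tends to 0 2-adically with F. *)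
Lemma two_bounded_horner (p : {poly algC}) : (forall i, two_bounded p`_i) ->
  exists e, forall F : nat, two_integral (2%:R ^+ e * p.[F%:R]).
Proof.
move=> hp.
suff [e he] : exists e, forall i, (i < size p)%N -> two_integral (2%:R ^+ e * p`_i).
  exists e => F; rewrite horner_coef mulr_sumr; apply: two_integral_sum => i _.
  rewrite mulrA; apply: two_integralM; first exact: he.
  exact/two_integralX/two_integral_nat.
elim: (size p) => [|s [e he]]; first by exists 0%N.
have [d hd] := hp s; exists (d + e)%N => i; rewrite ltnS leq_eqVlt exprD.
case/predU1P => [->|/he hi].
  by rewrite mulrAC; apply: two_integralM => //; rewrite -natrX; apply: two_integral_nat.
by rewrite -mulrA; apply: two_integralM => //; rewrite -natrX; apply: two_integral_nat.
Qed.

(** * Powers of odd numbers and of 5 modulo powers of 2 *)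

(** For y = 2b + 1, y^2 = 1 + 4b(b+1) with b(b+1) even; each further squaring gains one factor 2. *)
Lemma odd_expn_mod (y n : nat) : odd y -> (1 <= n)%N ->
  exists c, (y ^ (2 ^ n) = 1 + 2 ^ (n + 2) * c)%N.
Proof.
move=> oy; elim: n => // -[_ _|n IH _].
  have [b ->] : exists b, y = (b.*2.+1)%N by exists y./2; lia.
  have [c hc] : exists c, (b * b.+1 = c.*2)%N.
    by exists (b * b.+1)./2; have := odd_double_half (b * b.+1); rewrite oddM /= andbN.
  by exists c; rewrite !expnS expn0; nia.
have [c hc] := IH isT; exists (c * (1 + 2 ^ (n + 2) * c))%N.
rewrite expnSr expnM hc !addSn !expnS; nia.
Qed.

Lemma five_expn_mod (j : nat) :
  exists c, odd c /\ (5 ^ (2 ^ j) = 1 + 2 ^ (j + 2) * c)%N.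
Proof.
elim: j => [|j [c [oc hc]]]; first by exists 1%N.
exists (c * (1 + 2 ^ j.+1 * c))%N; split; first by rewrite oddM oc oddD oddM oddX.
rewrite expnSr expnM hc !addnS !addn0 !expnS; nia.
Qed.

(** Exact valuation: q grows by 2 at a time, and the extra factor 5^(2^(n+1)) is 1 modulo 2^(n+3),
    so the cofactor stays odd. *)
Lemma five_expn_odd (n q : nat) : odd q ->
  exists c, odd c /\ (5 ^ (2 ^ n * q) = 1 + 2 ^ (n + 2) * c)%N.
Proof.
move=> oq; have [c [oc hc]] := five_expn_mod n.
have [b ->] : exists b, q = (b.*2.+1)%N by exists q./2; lia.
elim: b => [|b [d [od hd]]]; first by exists c; rewrite muln1.
exists (d + (c.*2 + 2 ^ (n + 2) * c ^ 2) * (1 + 2 ^ (n + 2) * d))%N; split.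
  by rewrite oddD od !(oddM, oddD, odd_double) addnS oddX.
rewrite (_ : 2 ^ n * b.+1.*2.+1 = 2 ^ n * b.*2.+1 + 2 ^ n * 2)%N; last by lia.
by rewrite expnD hd expnM hc !expnS expn0; nia.
Qed.

(** * The coefficients B_{n,chi}/n! and power sums twisted by chi *)

Definition bern_coef (f : nat) (chi : int -> algC) (n : nat) : algC :=
  (gb_coefs f chi n.+1)`_n.

Lemma size_gb_coefs (f : nat) (chi : int -> algC) (n : nat) : size (gb_coefs f chi n) = n.
Proof. by elim: n => //= n IH; rewrite size_rcons IH. Qed.

Lemma nth_gb_coefs (f : nat) (chi : int -> algC) (n k : nat) : (k < n)%N ->
  (gb_coefs f chi n)`_k = bern_coef f chi k.
Proof.
elim: n => // n IH; rewrite ltnS leq_eqVlt => /predU1P[->//|lt].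
by rewrite /= nth_rcons size_gb_coefs lt IH.
Qed.

Lemma bern_coefE (f : nat) (chi : int -> algC) (n : nat) :
  bern_coef f chi n = (gb_rhs f chi n - \sum_(k < n) bern_coef f chi k *
    f%:R ^+ (n.+1 - k) / ((n.+1 - k)`!)%:R) / f%:R.
Proof.
rewrite /bern_coef /= nth_rcons size_gb_coefs ltnn eqxx.
by congr ((_ - _) / _); apply: eq_bigr => k _; rewrite nth_gb_coefs.
Qed.

Lemma fact_unit (n : nat) : (n`!%:R : algC) != 0.
Proof. by rewrite pnatr_eq0 -lt0n fact_gt0. Qed.

(* Up to normalization and the constant term, the Bernoulli polynomial of chi of degree n.+1. *)
Definition bern_prim (f : nat) (chi : int -> algC) (n : nat) : {poly algC} :=
  \sum_(k < n.+1) (bern_coef f chi k / (n.+1 - k)`!%:R) *: 'X^(n.+1 - k).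

Definition shifted_sum (f : nat) (chi : int -> algC) n : {poly algC} :=
  \sum_(1 <= a < f.+1) (chi a%:Z / n`!%:R) *: ('X + a%:R%:P) ^+ n.

Lemma deriv_bern_prim (f : nat) (chi : int -> algC) (n : nat) :
  (bern_prim f chi n.+1)^`() = bern_prim f chi n + (bern_coef f chi n.+1)%:P.
Proof.
rewrite /bern_prim raddf_sum big_ord_recr /= subSnn; congr (_ + _).
  apply: eq_bigr => k _; rewrite derivZ derivXn -scaler_nat scalerA.
  rewrite (subSn (ltnW (ltn_ord k))) factS natrM /=; congr (_ *: _).
  by field; rewrite fact_unit addrC natr1 pnatr_eq0.
by rewrite derivZ derivXn /= expr0 alg_polyC (_ : 1`! = 1%N) // divr1.
Qed.

Lemma deriv_shifted_sum (f : nat) (chi : int -> algC) (n : nat) :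
  (shifted_sum f chi n.+1)^`() = shifted_sum f chi n.
Proof.
rewrite /shifted_sum raddf_sum /=; apply: eq_bigr => a _.
rewrite derivZ deriv_exp derivD derivX derivC addr0 mul1r /= -scaler_nat scalerA.
by congr (_ *: _); rewrite factS natrM; field; rewrite fact_unit addrC natr1 pnatr_eq0.
Qed.

Lemma deriv_eq0 (p : {poly algC}) : p^`() = 0 -> p.[0] = 0 -> p = 0.
Proof.
move=> dp p0; apply/polyP ; case=> [|i]; first by rewrite coef0 -horner_coef0.
have := congr1 (fun q : {poly algC} => q`_i) dp; rewrite coef_deriv coef0 => /eqP.
by rewrite -mulr_natr mulf_eq0 pnatr_eq0 orbF coef0 => /eqP.
Qed.

(** The recursion defining the coefficients, read as the value of a polynomial at f. *)
Lemma bern_prim_rec (f : nat) (chi : int -> algC) (n : nat) : (0 < f)%N ->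
  (bern_prim f chi n).[f%:R] = (shifted_sum f chi n).[0].
Proof.
move=> f0; have fU : (f%:R : algC) != 0 by rewrite pnatr_eq0 -lt0n.
have -> : (shifted_sum f chi n).[0] = gb_rhs f chi n.
  rewrite horner_sum; apply: eq_bigr => a _.
  by rewrite hornerZ horner_exp !hornerE mulrAC.
rewrite horner_sum big_ord_recr /= subSnn hornerZ hornerXn expr1 divr1.
rewrite bern_coefE divfK // addrC -addrA -[RHS]addr0; congr (_ + _).
apply/eqP; rewrite addrC subr_eq0; apply/eqP.
by apply: eq_bigr => k _; rewrite hornerZ hornerXn mulrAC.
Qed.

(** Induction by differentiation: the derivative of the identity for n+1 is the identity for n, the
    extra constant cancelling in the difference, and at 0 the identity is [bern_prim_rec]. *)
Lemma bern_prim_shift (f : nat) (chi : int -> algC) (n : nat) : (0 < f)%N ->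
  bern_prim f chi n \Po ('X + f%:R%:P) - bern_prim f chi n = shifted_sum f chi n.
Proof.
move=> f0; apply/eqP; rewrite -subr_eq0; apply/eqP.
have at0 k : (bern_prim f chi k \Po ('X + f%:R%:P) - bern_prim f chi k
    - shifted_sum f chi k).[0] = 0.
  rewrite !hornerE horner_comp !hornerE bern_prim_rec //.
  rewrite [X in _ - X - _](_ : _ = 0) ?subr0 ?subrr //.
  rewrite horner_sum big1 // => i _.
  by rewrite hornerZ hornerXn expr0n subn_eq0 leqNgt ltn_ord mulr0.
elim: n => [|n IH]; apply: deriv_eq0 => //.
  rewrite /bern_prim /shifted_sum !big_ord1 subn0 expr1 comp_polyZ comp_polyX.
  rewrite scalerDr [_ *: 'X + _]addrC addrK derivB derivZ derivC scaler0 sub0r.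
  rewrite raddf_sum /= big1 ?oppr0 // => a _.
  by rewrite derivZ expr0 -polyC1 derivC scaler0.
rewrite !derivB deriv_comp deriv_bern_prim deriv_shifted_sum derivD derivX derivC.
by rewrite addr0 mulr1 comp_polyD comp_polyC opprD addrACA subrr addr0.
Qed.

Lemma periodic_mulz (chi : int -> algC) (f : nat) :
  (forall a, chi (a + f%:Z) = chi a) -> forall (M : nat) a, chi (a + (M * f)%N%:Z) = chi a.
Proof.
move=> per; elim=> [|M IH] a; first by rewrite addr0.
by rewrite mulSn addnC PoszD addrA per IH.
Qed.

(** [bern_prim_shift] telescopes over M periods, starting from the value 0 at 0. *)
Lemma bern_prim_mul (f : nat) (chi : int -> algC) (n M : nat) : (0 < f)%N -> (forall a, chi (a + f%:Z) = chi a) ->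
  (bern_prim f chi n).[(M * f)%:R] =
  (\sum_(0 <= a < M * f) chi a.+1%:Z * a.+1%:R ^+ n) / n`!%:R.
Proof.
move=> f0 per; elim: M => [|M IH].
  rewrite mul0n big_nil mul0r horner_sum big1 // => i _.
  by rewrite hornerZ hornerXn expr0n subn_eq0 leqNgt ltn_ord mulr0.
have := congr1 (horner^~ (M * f)%:R) (bern_prim_shift f chi n f0).
rewrite /= hornerD hornerN horner_comp !hornerE -natrD addnC -mulSn => /eqP.
rewrite subr_eq => /eqP ->; rewrite IH addrC mulSn addnC.
rewrite [in RHS](big_cat_nat (n:=(M * f)%N)) ?leq_addr //= mulrDl; congr (_ + _).
rewrite -{2}[(M * f)%N]add0n big_addn addnC addnK horner_sum big_add1 /= mulr_suml.
apply: eq_bigr => a _; rewrite hornerZ horner_exp !hornerE -addSn PoszD periodic_mulz //.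
by rewrite natrD mulrAC [X in _ * X ^+ _]addrC.
Qed.

Lemma two_bounded_bern_coef (f : nat) (chi : int -> algC) (n : nat) : (forall a, two_integral (chi a)) ->
  two_bounded (bern_coef f chi n).
Proof.
move=> chiI; elim/ltn_ind: n => n IH.
rewrite bern_coefE; apply: two_boundedM (two_boundedV _).
have natX (x k : nat) : two_bounded (x%:R ^+ k).
  exact/two_boundedI/two_integralX/two_integral_nat.
apply: two_boundedD.
  apply: two_bounded_sum => a _; apply: two_boundedM (two_boundedV _).
  by apply: two_boundedM => //; apply: two_boundedI.
rewrite -mulN1r; apply: two_boundedM.
  exact/two_boundedI/two_integralN/(two_integral_nat 1).
apply: two_bounded_sum => k _; apply: two_boundedM (two_boundedV _).
by apply: two_boundedM => //; apply: IH.
Qed.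

(* [bern_prim] has no constant term, so its value at F = M f divided by F tends
   2-adically to the coefficient of 'X when F tends to 0. *)
Lemma Lneg_approx (f : nat) (chi : int -> algC) (k : nat) : (0 < f)%N -> (forall a, chi (a + f%:Z) = chi a) ->
  (forall a, two_integral (chi a)) ->
  exists e, forall M, (0 < M)%N -> exists E, two_integral (2%:R ^+ e * E) /\
    Lneg f chi k = - (\sum_(0 <= a < M * f) chi a.+1%:Z * a.+1%:R ^+ k.+1)
                     / (k.+1%:R * (M * f)%:R) + (M * f)%:R * E.
Proof.
move=> f0 per chiI.
(* [G] is k! times the part of [bern_prim] of degree at least 2, divided by X^2. The remaining
   linear coefficient times -k! is L(-k, chi). *)
pose G := \sum_(j < k.+1) (k`!%:R * bern_coef f chi j / (k.+2 - j)`!%:R) *: 'X^(k - j) : {poly algC}.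
have [|e he] := two_bounded_horner G.
  move=> i; rewrite coef_sum; apply: two_bounded_sum => j _; rewrite coefZ coefXn.
  apply: two_boundedM; last exact/two_boundedI/two_integral_nat.
  apply: two_boundedM (two_boundedV _); apply: two_boundedM.
    exact/two_boundedI/two_integral_nat.
  exact: two_bounded_bern_coef.
exists e => M M0; exists G.[(M * f)%:R]; split=> //.
set F := (M * f)%:R : algC.
have FU : F != 0 by rewrite pnatr_eq0 muln_eq0 negb_or -!lt0n M0.
have := bern_prim_mul f chi k.+1 M f0 per; set S := \sum_(_ <= _ < _) _.
rewrite -/F /bern_prim big_ord_recr /= hornerD subSnn hornerZ hornerXn expr1 divr1.
have -> : (\sum_(i < k.+1) (bern_coef f chi i / ((k.+2 - i)`!)%:R) *: 'X^(k.+2 - i)).[F]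
  = F ^+ 2 * G.[F] / k`!%:R.
  rewrite !horner_sum mulr_sumr mulr_suml; apply: eq_bigr => i _.
  rewrite !hornerZ !hornerXn.
  rewrite (_ : (k.+2 - i)%N = (2 + (k - i))%N); last by have := ltn_ord i; lia.
  by rewrite exprD; field; rewrite !fact_unit.
move=> h.
have -> : Lneg f chi k = - k`!%:R * bern_coef f chi k.+1.
  rewrite /Lneg /gen_bernoulli -/(bern_coef f chi k.+1) factS natrM.
  by field; rewrite addrC natr1 pnatr_eq0.
have -> : S = (F ^+ 2 * G.[F] / k`!%:R + bern_coef f chi k.+1 * F) * k.+1`!%:R.
  by rewrite h divfK // fact_unit.
rewrite factS natrM; field.
by rewrite fact_unit addrC natr1 !pnatr_eq0 -!lt0n M0 f0.
Qed.

(** * Values of a primitive character modulo 2^m *)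

Section TwoPowerConductor.
Variables (m : nat) (chi : int -> algC).
Hypotheses (m3 : (3 <= m)%N) (chiP : primitive_dchar (2 ^ m) chi).

Local Notation zeta := (chi 5).
Local Notation varpi := (1 - chi 5).

Let chi1 : chi 1 = 1. Proof. by case: chiP => [[]]. Qed.
Let chiM a b : chi (a * b) = chi a * chi b. Proof. by case: chiP => [[]]. Qed.
Let chi_per a : chi (a + (2 ^ m)%N%:Z) = chi a. Proof. by case: chiP => [[]]. Qed.

Lemma chi_perz (a j : int) : chi (a + j * (2 ^ m)%N%:Z) = chi a.
Proof.
case: j => [j|j]; first by rewrite -PoszM periodic_mulz.
rewrite NegzE mulNr -PoszM -[LHS](periodic_mulz chi (2 ^ m) chi_per j.+1).
by rewrite subrK.
Qed.

Lemma chi_modn (a : nat) : chi (a %% 2 ^ m)%N%:Z = chi a%:Z.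
Proof. by rewrite [in RHS](divn_eq a (2 ^ m)) addnC PoszD PoszM chi_perz. Qed.

Lemma chi_even (a : nat) : ~~ odd a -> chi a%:Z = 0.
Proof.
move=> ea; apply/eqP; case: chiP => [[_ _ _ _ ->]] _.
by rewrite coprimezE /= coprime_pexpr ?coprimen2 //; lia.
Qed.

Lemma chiX (a k : nat) : chi (a ^ k)%N%:Z = chi a%:Z ^+ k.
Proof.
elim: k => [|k IH]; first by rewrite expn0 expr0 chi1.
by rewrite expnS PoszM chiM IH exprS.
Qed.

Lemma chi_odd_root (y : nat) : odd y -> chi y%:Z ^+ (2 ^ (m - 2)) = 1.
Proof.
move=> oy; have [|c hc] := odd_expn_mod y (m - 2) oy; first by lia.
by rewrite -chiX hc subnK ?(ltnW m3) // PoszD mulnC PoszM chi_perz chi1.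
Qed.

(** The power squares to 1, so it suffices that it is not 1. It is the value of chi at the
    nontrivial class congruent to 1 modulo 2^(m-1), where primitivity forbids the value 1. *)
Lemma zeta_root : zeta ^+ (2 ^ (m - 3)) = -1.
Proof.
have z2 : (zeta ^+ (2 ^ (m - 3))) ^+ 2 = 1.
  rewrite -exprM -expnSr (_ : (m - 3).+1 = (m - 2)%N); last by lia.
  exact: (chi_odd_root 5).
suff : zeta ^+ (2 ^ (m - 3)) != 1.
  by move/eqP: z2; rewrite sqrf_eq1 => /orP[/eqP->|/eqP->]; rewrite ?eqxx.
case: chiP => _ /(_ (2 ^ (m - 1))%N)[| |a [_ am chia]].
- by rewrite dvdn_exp2l ?leq_subr.
- by rewrite ltn_exp2l //; lia.
have [c [oc hc]] := five_expn_mod (m - 3).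
rewrite -(chiX 5) hc (_ : m - 3 + 2 = m - 1)%N; last by lia.
move: am; rewrite eqz_mod_dvd => /dvdzP[b hb].
have aE : a = 1 + b * (2 ^ (m - 1))%N%:Z by rewrite -hb addrC subrK.
have mE : (2 ^ m = 2 * 2 ^ (m - 1))%N by rewrite -expnS; congr (_ ^ _)%N; lia.
(* If b is even, a is 1 modulo 2^m, against [chi a != 1]; if b is odd, a is 5^(2^(m-3)) modulo
   2^m. *)
have [j [h|h]] : exists j : int, b = j * 2 \/ b = c%:Z + j * 2.
  have [h|h] : (exists j : int, b = j * 2) \/ (exists j : int, b = j * 2 + 1) by
    have := divz_eq b 2; have := modz_ge0 b (isT : 2 != 0 :> int);
    have := ltz_mod b (isT : 2 != 0 :> int) => ? ? ?;
    case: (eqVneq (b %% 2)%Z 0) => ?; [left|right]; exists (b %/ 2)%Z; lia.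
  - by case: h => j ->; exists j; left.
  - case: h => j ->; exists (j - (c./2)%:Z); right; lia.
- move: chia; rewrite aE h -mulrA -[2 * _]PoszM -mE chi_perz chi1 eqxx //.
suff <- : chi a = chi (1 + 2 ^ (m - 1) * c)%N%:Z by [].
rewrite -[RHS](chi_perz _ j) aE h mE; congr chi; lia.
Qed.

(** * The element varpi above 2 and the Euler factors *)

Lemma varpi_neq0 : varpi != 0.
Proof.
rewrite subr_eq0 eq_sym; apply: contra_eqN zeta_root => /eqP->.
by rewrite expr1n -subr_eq0 opprK -mulr2n pnatr_eq0.
Qed.

Lemma chi_Aint_nat (a : nat) : chi a%:Z \in Aint.
Proof.
have [oa|/chi_even ->] := boolP (odd a); last exact: rpred0.
apply: (@Aint_unity_root (2 ^ (m - 2))); first by rewrite expn_gt0.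
by apply/unity_rootP; apply: chi_odd_root.
Qed.

Lemma chi_Aint (a : int) : chi a \in Aint.
Proof.
case: a => [a|a]; first exact: chi_Aint_nat.
rewrite NegzE -mulN1r chiM rpredM ?chi_Aint_nat //.
apply: (@Aint_unity_root 2) => //.
by apply/unity_rootP; rewrite expr2 -chiM.
Qed.

Lemma chi_two_integral (a : int) : two_integral (chi a).
Proof. exact/two_integral_Aint/chi_Aint. Qed.

(** The order divides 2^(m-2), and [zeta_root] excludes proper divisors. Hence every chi(y) with y
    odd is a power of zeta. *)
Lemma zeta_primitive : (2 ^ (m - 2)).-primitive_root zeta.
Proof.
have [|d dP] := prim_order_exists _ (chi_odd_root 5 isT); first by rewrite expn_gt0.
move=> /(dvdn_pfactor _ _ (isT : prime 2))[e le dE]; move: dP; rewrite dE.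
move: le; rewrite leq_eqVlt => /predU1P[->//|lt] dP.
have : zeta ^+ (2 ^ (m - 3)) = 1.
  apply/eqP; rewrite -(prim_order_dvd dP) dvdn_exp2l //; lia.
by rewrite zeta_root => /eqP; rewrite eqr_oppLR -subr_eq0 opprK -mulr2n pnatr_eq0.
Qed.

(** chi(y) is a power zeta^i, and 1 - zeta divides 1 - zeta^i. *)
Lemma chi_mod_varpi (y : nat) : odd y -> cmod varpi (chi y%:Z) 1.
Proof.
move=> oy; have [i ->] := prim_rootP zeta_primitive (chi_odd_root y oy).
rewrite /cmod -opprB -{1}(expr1n algC i) subrXX mulNr mulrAC divff ?varpi_neq0 // mul1r.
apply/two_integralN/two_integral_sum => j _; apply: two_integralM.
  exact/two_integralX/(two_integral_nat 1).
exact/two_integralX/chi_two_integral.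
Qed.

Lemma varpi_two_integral : two_integral varpi.
Proof. exact: two_integralB (two_integral_nat 1) (chi_two_integral 5). Qed.

(** The geometric sum telescopes to 1 - (-1) by [zeta_root]; so varpi divides 2. *)
Lemma varpi_mul_geom : varpi * (\sum_(i < 2 ^ (m - 3)) zeta ^+ i) = 2%:R.
Proof.
have := subrXX 1 zeta (2 ^ (m - 3)); rewrite expr1n zeta_root opprK -mulr2n => ->.
by congr (_ * _); apply: eq_bigr => i _; rewrite expr1n mul1r.
Qed.

Lemma two_div_varpi : two_integral (2%:R / varpi).
Proof.
rewrite -varpi_mul_geom mulrC mulKf ?varpi_neq0 //.
by apply: two_integral_sum => i _; apply/two_integralX/chi_two_integral.
Qed.

Lemma cmod2_varpi (x y : algC) : cmod 2%:R x y -> cmod varpi x y.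
Proof. by apply: cmod_dvd; [exact: two_div_varpi | exact: two_unit]. Qed.

Lemma cmod_varpi_odd (s : nat) : odd s -> cmod varpi s%:R 1.
Proof.
move=> os; apply: cmod2_varpi; rewrite /cmod.
have -> : (s%:R : algC) = 1 + 2%:R * (s./2)%:R.
  by rewrite -{1}(odd_double_half s) os natrD -mul2n natrM.
rewrite addrC addKr mulrC mulKf ?two_unit //; exact: two_integral_nat.
Qed.

(** Repeated use of (1-w)^2 - (1-w^2) = -2w(1-w). *)
Lemma frobenius_mod2 (z : algC) (j : nat) : two_integral z ->
  cmod 2%:R ((1 - z) ^+ (2 ^ j)) (1 - z ^+ (2 ^ j)).
Proof.
move=> hz; elim: j => [|j IH]; first exact: cmod_refl.
have T1z i : two_integral (1 - z ^+ i).
  by apply: two_integralB (two_integral_nat 1) _; apply: two_integralX.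
rewrite expnSr !exprM; apply: (cmod_trans _ ((1 - z ^+ (2 ^ j)) ^+ 2)).
  rewrite !expr2; apply: cmodM => //; apply: two_integralX.
  exact: two_integralB (two_integral_nat 1) _.
rewrite /cmod; set w := z ^+ _.
have -> : ((1 - w) ^+ 2 - (1 - w ^+ 2)) / 2%:R = - (w * (1 - w)) by field.
by apply/two_integralN/two_integralM; rewrite /w //; apply: two_integralX.
Qed.

(* The power varpi^(2^(m-3)) is divisible by 2, as it is congruent to 1 - zeta^(2^(m-3)) = 2. *)
Lemma varpi_not_unit : ~ two_integral varpi^-1.
Proof.
move=> hV; apply: two_integral_half.
have := frobenius_mod2 zeta (m - 3) (chi_two_integral 5).
rewrite zeta_root opprK -mulr2n /cmod mulrBl divff ?two_unit // => h.
have {}h := two_integralD _ _ h (two_integral_nat 1); rewrite subrK in h.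
have := two_integralM _ _ h (two_integralX _ (2 ^ (m - 3)) hV).
by rewrite exprVn mulrC mulKf // expf_neq0 ?varpi_neq0.
Qed.

(* The Euler-type factor that makes [euler5 k * L(-k, chi)] 2-integral (and even). *)
Definition euler5 (k : nat) : algC := 1 - zeta * 5%:R ^+ k.+1.

Lemma five_mod4 (e : nat) : exists d, (5 ^ e = 1 + 4 * d)%N.
Proof.
elim: e => [|e [d IH]]; first by exists 0%N.
by exists (5 * d + 1)%N; rewrite expnS IH; lia.
Qed.

(* The geometric sum A of x = zeta * 5^(k+1) satisfies (1 - x) A = 1 + 5^((k+1) 2^(m-3)),
   twice an odd number, because zeta^(2^(m-3)) = -1; and A is congruent modulo 4 to the
   geometric sum of zeta, which is 2 / varpi. *)
Lemma euler5_unit (k : nat) :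
  [/\ euler5 k != 0, two_integral (varpi / euler5 k) & cmod 2%:R (varpi / euler5 k) 1].
Proof.
pose M := (2 ^ (m - 3))%N; pose x := zeta * 5%:R ^+ k.+1.
pose A := \sum_(i < M) x ^+ i.
have [o [oo hd]] : exists o, odd o /\ (1 + 5 ^ (k.+1 * M) = 2 * o)%N.
  by have [d ->] := five_mod4 (k.+1 * M); exists (1 + 2 * d)%N; split; lia.
have uA : euler5 k * A = 2%:R * o%:R.
  have := subrXX 1 x M; rewrite expr1n.
  under eq_bigr => i _ do rewrite expr1n mul1r.
  rewrite -/A -/(euler5 k) => <-.
  by rewrite exprMn zeta_root -exprM -natrX -natrM -hd; ring.
have oU : (o%:R : algC) != 0 by rewrite pnatr_eq0; case: o oo {hd uA}.
have u0 : euler5 k != 0.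
  apply: contra_neq (mulf_neq0 two_unit oU) => e; by rewrite -uA e mul0r.
(* Since 1/u_k = A/(2o), v_k splits into varpi A / 2 and 1/o, each of which is 1 modulo 2. *)
have vE : varpi / euler5 k = varpi * A / 2%:R * o%:R^-1.
  apply: (mulIf u0); rewrite divfK //.
  have -> : varpi * A / 2%:R / o%:R * euler5 k = varpi * (euler5 k * A) / (2%:R * o%:R).
    by field.
  by rewrite uA mulfK // mulf_neq0 // two_unit.
have hA : cmod (2%:R ^+ 2) A (\sum_(i < M) zeta ^+ i).
  apply: cmod_sum => i _; rewrite exprMn -[X in cmod _ _ X]mulr1 -exprM.
  have [c hc] := five_mod4 (k.+1 * i).
  rewrite /cmod -mulrBr -[5%:R ^+ _]natrX hc natrD addrC addKr natrM.
  have -> : zeta ^+ i * (4%:R * c%:R) / 2%:R ^+ 2 = zeta ^+ i * c%:R by field.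
  apply: two_integralM (two_integral_nat _).
  exact/two_integralX/chi_two_integral.
have v1 : cmod 2%:R (varpi * A / 2%:R) 1.
  have g1 : varpi * (\sum_(i < M) zeta ^+ i) / 2%:R = 1.
    by rewrite varpi_mul_geom divff ?two_unit.
  rewrite -[X in cmod _ _ X]g1.
  have := two_integralM _ _ varpi_two_integral hA.
  by rewrite /cmod; congr two_integral; field.
have oV := two_integral_oddV _ oo.
have v2 : cmod 2%:R o%:R^-1 1.
  have := two_integralN _ (two_integralM _ _ (two_integral_nat o./2) oV).
  rewrite /cmod; congr two_integral.
  have oE : (o%:R : algC) = 1 + 2%:R * (o./2)%:R.
    by rewrite -{1}(odd_double_half o) oo natrD -mul2n natrM.
  by rewrite oE in oU *; field.
have v0 : two_integral (varpi * A / 2%:R).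
  have := two_integralD _ _ (two_integralM _ _ v1 (two_integral_nat 2)) (two_integral_nat 1).
  by rewrite divfK ?two_unit // subrK.
split=> //; rewrite vE; first exact: two_integralM.
by rewrite -[X in cmod _ _ X]mulr1; apply: cmodM => //; apply: (two_integral_nat 1).
Qed.

(** * The floor sum and its limit u_k L(-k, chi) *)

Lemma binomial_mod_sqr (w x t : algC) (k : nat) : w != 0 ->
  two_integral w -> two_integral x -> two_integral t ->
  cmod (w ^+ 2) ((x - t * w) ^+ k.+1) (x ^+ k.+1 - k.+1%:R * t * w * x ^+ k).
Proof.
move=> w0 wI xI tI; have dI : two_integral (x - t * w).
  by apply: two_integralB => //; apply: two_integralM.
elim: k => [|k IH].
  rewrite expr0 !expr1 mul1r mulr1; exact: cmod_refl.
rewrite exprS; apply: (cmod_trans _ ((x - t * w) * (x ^+ k.+1 - k.+1%:R * t * w * x ^+ k))).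
  apply: cmodM => //; last exact: cmod_refl.
  apply: two_integralB; first exact: two_integralX.
  apply: two_integralM; last exact: two_integralX.
  by do 2! apply: two_integralM => //; apply: two_integral_nat.
have := two_integralM _ _ (two_integralM _ _ (two_integral_nat k.+1)
  (two_integralX _ 2 tI)) (two_integralX _ k xI).
rewrite /cmod; congr two_integral; rewrite !exprS -[k.+2]addn1 natrD; field.
by rewrite w0.
Qed.

Lemma sum_mul5_modn (N : nat) (G : nat -> algC) :
  \sum_(0 <= a < 2 ^ N) G ((5 * a) %% 2 ^ N)%N = \sum_(0 <= a < 2 ^ N) G a.
Proof.
rewrite !big_mkord; have F0 : (0 < 2 ^ N)%N by rewrite expn_gt0.
pose h (a : 'I_(2 ^ N)) := Ordinal (ltn_pmod (5 * a) F0).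
have hI : injective h.
  have le_inj (a b : 'I_(2 ^ N)) : (a <= b)%N -> h a = h b -> a = b.
    move=> ab /(congr1 val) /= /eqP; rewrite eq_sym eqn_mod_dvd; last by lia.
    rewrite -mulnBr Gauss_dvdr ?coprimeXl // => /dvdn_leq /=.
    by have := ltn_ord b; move=> lb le; apply/val_inj => /=; case: (posnP (b - a)) => [|/le]; lia.
  by move=> a b; case: (leqP a b) => [|/ltnW] ab e; [|symmetry]; apply: le_inj.
by rewrite [RHS](reindex_inj hI).
Qed.

(** The floor is the carry t in 5a = (5a mod F) + tF, with F = 2^N. *)
Definition floor_sum (N k : nat) : algC :=
  \sum_(0 <= a < 2 ^ N) (5 * a %/ 2 ^ N)%:R * (chi (5 * a)%N%:Z * (5 * a)%:R ^+ k).

(** Both end terms vanish: at 0 the exponent is positive, and 2^N is even. *)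
Lemma sum_chi_shift (N k : nat) : (m <= N)%N ->
  \sum_(0 <= a < 2 ^ N) chi a.+1%:Z * a.+1%:R ^+ k.+1 =
  \sum_(0 <= a < 2 ^ N) chi a%:Z * a%:R ^+ k.+1.
Proof.
move=> mN; pose g (a : nat) := chi a%:Z * a%:R ^+ k.+1.
have g0 : g 0%N = 0 by rewrite /g expr0n mulr0.
have gF : g (2 ^ N)%N = 0 by rewrite /g chi_even ?mul0r // oddX; lia.
apply: (addrI (g 0%N)); rewrite -(big_nat_recl _ _ g) // big_nat_recr //=.
by rewrite gF g0 addr0 add0r.
Qed.

(* Multiplication by 5 permutes the residues a modulo F = 2^N; expand the power of
   5a mod F = 5a - F t to first order in F. *)
Lemma euler5_sum (N k : nat) : (m <= N)%N ->
  cmod ((2 ^ N)%:R ^+ 2)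
    (euler5 k * \sum_(0 <= a < 2 ^ N) chi a.+1%:Z * a.+1%:R ^+ k.+1)
    (- (k.+1%:R * (2 ^ N)%:R * floor_sum N k)).
Proof.
move=> mN; rewrite sum_chi_shift //.
set S := \sum_(_ <= _ < _) _; rewrite /euler5 mulrBl mul1r.
have -> : zeta * 5%:R ^+ k.+1 * S =
    \sum_(0 <= a < 2 ^ N) chi (5 * a)%N%:Z * (5 * a)%:R ^+ k.+1.
  rewrite mulr_sumr; apply: eq_bigr => a _.
  by rewrite PoszM chiM natrM exprMn; ring.
rewrite {}/S -sum_mul5_modn -sumrB /floor_sum mulr_sumr -sumrN.
apply: cmod_sum => a _.
have -> : chi (5 * a %% 2 ^ N)%N%:Z = chi (5 * a)%N%:Z.
  by rewrite -chi_modn modn_dvdm ?dvdn_exp2l // chi_modn.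
set x := (5 * a)%N; set F := (2 ^ N)%N; set t := (x %/ F)%N.
have F0 : (F%:R : algC) != 0 by rewrite pnatr_eq0 -lt0n expn_gt0.
have -> : ((x %% F)%:R : algC) = x%:R - t%:R * F%:R.
  by rewrite {2}(divn_eq x F) natrD natrM addrC addKr.
have := binomial_mod_sqr F%:R x%:R t%:R k F0 (two_integral_nat _)
  (two_integral_nat _) (two_integral_nat _).
move=> /(two_integralM _ _ (chi_two_integral x)); rewrite /cmod; congr two_integral.
set y := (_ - _) ^+ _; rewrite mulrA; congr (_ / _); ring.
Qed.

Lemma Lneg_floor_sum (k r : nat) : exists N0, forall N, (N0 <= N)%N ->
  cmod (2%:R ^+ r) (euler5 k * Lneg (2 ^ m) chi k) (floor_sum N k).
Proof.
have [|e he] := Lneg_approx (2 ^ m) chi k _ chi_per chi_two_integral.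
  by rewrite expn_gt0.
have [d hd] := two_boundedV k.+1.
(* Here e bounds the denominator of E and d that of 1/(k+1). The errors are F E and a multiple of
   F/(k+1), both divisible by 2^r once N >= e + d + r. *)
exists (maxn m (e + d + r)) => N; rewrite geq_max => /andP[mN eN].
have [|E [hE ->]] := he (2 ^ (N - m))%N; first by rewrite expn_gt0.
rewrite -expnD subnK //.
have := euler5_sum N k mN; set S := \sum_(_ <= _ < _) _; set F := (2 ^ N)%:R.
have F0 : F != 0 :> algC by rewrite pnatr_eq0 -lt0n expn_gt0.
have uI : two_integral (euler5 k).
  apply: two_integralB; first exact: (two_integral_nat 1).
  apply: two_integralM; first exact: chi_two_integral.
  exact/two_integralX/two_integral_nat.
have FE : F = 2%:R ^+ (N - (e + d + r)) * 2%:R ^+ e * 2%:R ^+ d * 2%:R ^+ r.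
  by rewrite -!exprD /F natrX; congr (_ ^+ _); lia.
move=> hS.
have h1 := two_integralN _ (two_integralM _ _ (two_integralM _ _ hS hd)
  (two_integral_nat (2 ^ (N - (e + d + r)) * 2 ^ e))).
have h2 := two_integralM _ _ (two_integralM _ _ uI hE)
  (two_integral_nat (2 ^ (N - (e + d + r)) * 2 ^ d)).
have := two_integralD _ _ h1 h2; rewrite /cmod; congr two_integral.
have pow0 i : 2%:R ^+ i != 0 :> algC by rewrite expf_neq0 // two_unit.
have k0 : (k.+1%:R : algC) != 0 by rewrite pnatr_eq0.
rewrite !natrM !natrX FE.
move: (pow0 (N - (e + d + r))%N) (pow0 e) (pow0 d) (pow0 r).
move: (2%:R ^+ (N - _)) (2%:R ^+ e) (2%:R ^+ d) (2%:R ^+ r) => a b c s a0 b0 c0 s0.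
move: (k.+1%:R) k0 => K K0; field; by rewrite a0 b0 c0 s0 K0.
Qed.

(** * Folding the floor sum to half its length *)

Lemma sum_odd_terms (G : nat -> algC) (n : nat) : (forall b, G b.*2 = 0) ->
  \sum_(0 <= a < n.*2) G a = \sum_(0 <= b < n) G b.*2.+1.
Proof.
move=> G0; elim: n => [|n IH]; first by rewrite !big_nil.
by rewrite doubleS !big_nat_recr //= IH G0 addr0.
Qed.

(** For a = 2b + 1 and F = 4n, the pairing of b with 2n - 1 - b is a -> F - a. *)
Lemma sum_fold_half (G : nat -> algC) (n : nat) :
  \sum_(0 <= b < n.*2) G b = \sum_(0 <= b < n) (G b + G (n.*2 - b.+1)%N).
Proof.
rewrite (big_cat_nat (n:=n)) //=; last by lia.
rewrite big_split /=; congr (_ + _).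
rewrite big_nat_rev /= -{1}[n]add0n big_addn (_ : n.*2 - n = n)%N; last by lia.
by apply: eq_bigr => i _; congr G; lia.
Qed.

(** The level N approximation to h_k; the 2^(N-2) indices b give the odd a = 2b + 1 below F/2. *)
Definition half_floor_sum (N k : nat) : algC :=
  \sum_(0 <= b < 2 ^ (N - 2))
     ((5 * b.*2.+1 %/ 2 ^ N)%:R - 2%:R) *
     (chi (5 * b.*2.+1)%N%:Z * (5 * b.*2.+1)%:R ^+ k).

(* Under a -> F - a the floor t becomes 4 - t, and by the parity condition the weight
   chi(5a)(5a)^k changes sign modulo F, so the two terms add up to 2(t - 2) times it. *)
Lemma floor_sum_fold (N k : nat) : (m <= N)%N -> chi (-1) != (-1) ^+ k ->
  cmod (2%:R ^+ N) (floor_sum N k) (2%:R * half_floor_sum N k).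
Proof.
move=> mN par; set H := (2 ^ (N - 2))%N.
have FE : (2 ^ N = H.*2.*2)%N by rewrite -!mul2n /H -!expnS; congr expn; lia.
have parE : chi (-1) = - (-1) ^+ k.
  have : chi (-1) ^+ 2 == 1 by rewrite expr2 -chiM mulrNN mulr1 chi1.
  move: par; rewrite sqrf_eq1 -signr_odd.
  by case: (odd k); rewrite ?expr0 ?expr1 ?opprK => nz /orP[]/eqP e //;
    rewrite e eqxx in nz.
rewrite /floor_sum {1}FE sum_odd_terms; last first.
  by move=> b; rewrite chi_even ?mul0r ?mulr0 // oddM odd_double andbF.
rewrite sum_fold_half /half_floor_sum mulr_sumr big_nat_cond [X in cmod _ _ X]big_nat_cond.
apply: cmod_sum => b; rewrite andbT => /andP[_ bH].
set y := (5 * b.*2.+1)%N; set t := (y %/ _)%N.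
have yE : (5 * (H.*2 - b.+1).*2.+1 = 5 * 2 ^ N - y)%N by rewrite /y FE; lia.
rewrite yE.
have F0 : (0 < 2 ^ N)%N by rewrite expn_gt0.
(* As y is odd, F does not divide it, so the floor of (5F - y)/F is 4 - t and not 5 - t. *)
have yr : (0 < y %% 2 ^ N)%N.
  rewrite lt0n; apply/negP => /dvdnP[c hc].
  have : odd y by rewrite /y oddM /= odd_double.
  by rewrite hc oddM oddX; lia.
have yF : (y < 5 * 2 ^ N)%N by rewrite /y FE; lia.
have tE := divn_eq y (2 ^ N); have rF := ltn_pmod y F0.
have t4 : (t <= 4)%N by rewrite -ltnS ltn_divLR.
have -> : ((5 * 2 ^ N - y) %/ 2 ^ N = 4 - t)%N.
  rewrite (_ : 5 * 2 ^ N - y = (4 - t) * 2 ^ N + (2 ^ N - y %% 2 ^ N))%N.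
    by rewrite divnMDl // divn_small ?addn0 //; lia.
  rewrite mulnBl -/t in tE *. have : (t * 2 ^ N <= 4 * 2 ^ N)%N by rewrite leq_mul2r t4 orbT. lia.
have chE : chi (5 * 2 ^ N - y)%N%:Z = - (-1) ^+ k * chi y.
  rewrite -subzn; last exact: ltnW.
  by rewrite -(subnK mN) expnD mulnA PoszM addrC chi_perz -[- y%:Z]mulN1r chiM parE.
have powE : cmod (2%:R ^+ N) ((5 * 2 ^ N - y)%:R ^+ k) ((-1) ^+ k * y%:R ^+ k).
  rewrite -exprMn mulN1r; clear par parE chE; elim: k => [|k IH]; first exact: cmod_refl.
  rewrite !exprS; apply: cmodM => //; first exact: two_integral_nat.
    exact/two_integralX/two_integralN/two_integral_nat.
  rewrite /cmod natrB ?(ltnW yF) // opprK subrK natrM natrX mulfK ?expf_neq0 ?two_unit //.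
  exact: (two_integral_nat 5).
rewrite chE natrB //.
have yI : two_integral (y%:R ^+ k) by apply/two_integralX/two_integral_nat.
have sI : two_integral ((-1) ^+ k).
  exact/two_integralX/two_integralN/(two_integral_nat 1).
apply: (cmod_trans _ (t%:R * (chi y * y%:R ^+ k) +
   (4%:R - t%:R) * (- (-1) ^+ k * chi y * ((-1) ^+ k * y%:R ^+ k)))).
  apply: cmodD; first exact: cmod_refl.
  have cI : two_integral ((4%:R - t%:R) * (- (-1) ^+ k * chi y)).
    apply: two_integralM; first by apply: two_integralB; apply: two_integral_nat.
    by apply: two_integralM; [exact: two_integralN | exact: chi_two_integral].
  rewrite !mulrA -![_ * chi y]mulrA; rewrite -[X in cmod _ _ X]mulrA.
  apply: cmodM => //; [exact: two_integralM | exact: cmod_refl].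
have s2 : (-1) ^+ k * (-1) ^+ k = 1 :> algC by rewrite -exprMn mulrNN mulr1 expr1n.
have -> : (- (-1) ^+ k * chi y * ((-1) ^+ k * y%:R ^+ k)) = - (chi y * y%:R ^+ k).
  by rewrite mulrACA mulNr s2 mulN1r.
have -> : 2%:R * ((t%:R - 2%:R) * (chi y * y%:R ^+ k)) =
  t%:R * (chi y * y%:R ^+ k) + (4%:R - t%:R) * - (chi y * y%:R ^+ k).
  move: (chi y * _) => z; ring.
exact: cmod_refl.
Qed.

(** * The half sums modulo 2^(n+2) and modulo varpi *)

Lemma half_floor_sum_cong (N n q k : nat) : (1 <= n)%N ->
  cmod (2%:R ^+ (n + 2)) (half_floor_sum N (k + 2 ^ n * q)) (half_floor_sum N k).
Proof.
move=> n1; apply: cmod_sum => b _; rewrite /cmod -!mulrBr -!mulrA.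
apply: two_integralM; first by apply: two_integralB; apply: two_integral_nat.
apply: two_integralM; first exact: chi_two_integral.
set y := (5 * _)%N; have oy : odd y by rewrite /y oddM /= odd_double.
have [c hc] := odd_expn_mod y n oy n1.
have [d hd] : exists d, ((y ^ (2 ^ n)) ^ q = 1 + 2 ^ (n + 2) * d)%N.
  rewrite hc; elim: q => [|q [d IH]]; first by exists 0%N; rewrite muln0.
  exists (c + d + 2 ^ (n + 2) * c * d)%N; rewrite expnS IH; ring.
rewrite exprD -[y%:R ^+ (_ * _)]natrX expnM hd natrD mulrDr mulr1 addrC addKr.
rewrite natrM natrX mulrA mulrAC mulfK ?expf_neq0 ?two_unit // -natrX -natrM.
exact: two_integral_nat.
Qed.

(* For F = 2^N = 4(5s+1), the floor is 0, 1, 2 on the blocks [0, 2s), [2s, 4s+1),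
   [4s+1, 5s+1), so the sum has the parity of the middle block, of length 2s + 1. *)
Lemma half_floor_sum_count (j : nat) :
  odd (\sum_(0 <= b < 2 ^ (4 * j)) (5 * b.*2.+1 %/ 2 ^ (4 * j + 2)))%N.
Proof.
(* The exponent is a multiple of 4 because 16 is 1 modulo 5. *)
have [s hs] : exists s, (2 ^ (4 * j) = 5 * s + 1)%N.
  elim: j => [|j [s hs]]; first by exists 0%N.
  by exists (16 * s + 3)%N; rewrite mulnS expnD hs; lia.
rewrite expnD hs.
rewrite (big_cat_nat (n := (2 * s)%N)) //=; last by lia.
rewrite (big_cat_nat (m := (2 * s)%N) (n := (4 * s + 1)%N)) //=; try lia.
rewrite (eq_big_nat (m := 0%N) _ _ (F2 := fun=> 0%N)); last first.
  by move=> b /andP[_ hb]; apply: divn_small; lia.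
rewrite (eq_big_nat (m := (2 * s)%N) _ _ (F2 := fun=> 1%N)); last first.
  by move=> b /andP[b1 b2]; apply/eqP; rewrite eqn_leq -ltnS ltn_divLR ?leq_divRL; lia.
rewrite (eq_big_nat (m := (4 * s + 1)%N) _ _ (F2 := fun=> 2%N)); last first.
  by move=> b /andP[b1 b2]; apply/eqP; rewrite eqn_leq -ltnS ltn_divLR ?leq_divRL; lia.
by rewrite !sum_nat_const_nat; lia.
Qed.

(** Modulo varpi, 2 vanishes and chi(y) y^k is 1 for odd y, leaving the odd sum of floors. Levels 4j
    + 2 suffice, being arbitrarily large. *)
Lemma half_floor_sum_unit (j k : nat) :
  cmod varpi (half_floor_sum (4 * j + 2) k) 1.
Proof.
apply: (cmod_trans _ (\sum_(0 <= b < 2 ^ (4 * j)) (5 * b.*2.+1 %/ 2 ^ (4 * j + 2))%:R)).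
  rewrite /half_floor_sum addnK; apply: cmod_sum => b _.
  rewrite -[X in cmod _ _ X]mulr1; set y := (5 * _)%N.
  have oy : odd y by rewrite /y oddM /= odd_double.
  apply: cmodM.
  - by apply: two_integralB; apply: two_integral_nat.
  - exact: (two_integral_nat 1).
  - apply: cmod2_varpi; rewrite /cmod addrC addKr mulNr divff ?two_unit //.
    exact/two_integralN/(two_integral_nat 1).
  rewrite -[X in cmod _ _ X]mulr1; apply: cmodM.
  - exact: chi_two_integral.
  - exact: (two_integral_nat 1).
  - exact: chi_mod_varpi.
  by rewrite -natrX; apply: cmod_varpi_odd; rewrite oddX oy orbT.
by rewrite -natr_sum; apply/cmod_varpi_odd/half_floor_sum_count.
Qed.

(** * Passage to the limit and comparison of the values of calL *)

Lemma zeta_neq0 : zeta != 0.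
Proof.
apply: contra_eq_neq (chi_odd_root 5 isT) => ->.
by rewrite expr0n expn_eq0 /= eq_sym oner_eq0.
Qed.

Lemma conj_zeta : zeta^* = zeta^-1.
Proof.
have nz : `|zeta| = 1.
  apply/eqP; rewrite -(@pexpr_eq1 _ _ (2 ^ (m - 2))) ?expn_gt0 ?normr_ge0 //.
  by rewrite -normrX (chi_odd_root 5) // normr1.
apply: (mulfI zeta_neq0); rewrite divff ?zeta_neq0 //.
by rewrite -normCK nz expr1n.
Qed.

Lemma cmod_varpi_integral (x : algC) : cmod varpi x 1 -> two_integral x.
Proof.
move=> /two_integralM/(_ varpi_two_integral) h.
have := two_integralD _ _ h (two_integral_nat 1).
by rewrite divfK ?varpi_neq0 // subrK.
Qed.

Lemma cmod_varpi_mul1 (x y : algC) :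
  cmod varpi x 1 -> cmod varpi y 1 -> cmod varpi (x * y) 1.
Proof.
move=> hx hy; rewrite -[X in cmod _ _ X]mulr1; apply: cmodM => //.
  exact: cmod_varpi_integral.
exact: (two_integral_nat 1).
Qed.

(** The limit h_k of the half sums when k has parity opposite to chi. *)
Definition half_euler_L (k : nat) : algC := euler5 k * Lneg (2 ^ m) chi k / 2%:R.

Lemma calL_half_euler_L (k : nat) :
  calL (2 ^ m) chi k = 2%:R * (half_euler_L k * (varpi / euler5 k)).
Proof.
have [u0 _ _] := euler5_unit k.
by rewrite /calL /half_euler_L; field.
Qed.

Lemma half_euler_L_approx (k r : nat) : chi (-1) != (-1) ^+ k ->
  exists N0, forall N, (N0 <= N)%N ->
    cmod (2%:R ^+ r) (half_euler_L k) (half_floor_sum N k).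
Proof.
(* One extra power of 2 pays for the division by 2. *)
move=> par; have [N0 hN] := Lneg_floor_sum k r.+1.
exists (N0 + m + r.+1)%N => N NN0.
have h1 := hN N ltac:(lia).
have h2 := cmod_le r.+1 N _ _ ltac:(lia) (floor_sum_fold N k ltac:(lia) par).
have := cmod_trans _ _ _ _ h1 h2; rewrite /cmod /half_euler_L; congr two_integral.
rewrite exprS; field; by rewrite expf_neq0 // two_unit.
Qed.

Lemma parity_shift (n q k : nat) : (1 <= n)%N ->
  (-1) ^+ (k + 2 ^ n * q) = (-1) ^+ k :> algC.
Proof.
move=> n1; rewrite -signr_odd oddD oddM oddX.
by case: n n1 => //= n _; rewrite addbF signr_odd.
Qed.

Lemma half_euler_L_cong (n q k : nat) : (1 <= n)%N -> chi (-1) != (-1) ^+ k ->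
  cmod (2%:R ^+ (n + 2)) (half_euler_L (k + 2 ^ n * q)) (half_euler_L k).
Proof.
move=> n1 par; have [N1 h1] := half_euler_L_approx k (n + 2) par.
have [|N2 h2] := half_euler_L_approx (k + 2 ^ n * q) (n + 2).
  by rewrite parity_shift.
apply: (cmod_trans _ _ _ _ (h2 (N1 + N2)%N ltac:(lia))).
apply: (cmod_trans _ _ _ _ (half_floor_sum_cong (N1 + N2) n q k n1)).
by apply/cmod_sym/h1; lia.
Qed.

Lemma half_euler_L_unit (k : nat) : chi (-1) != (-1) ^+ k ->
  cmod varpi (half_euler_L k) 1.
Proof.
(* Precision 2 suffices, as varpi divides 2; the level 4N + 2 is beyond N and of the form already
   counted. *)
move=> par; have [N hN] := half_euler_L_approx k 1 par.
apply: cmod_trans (half_floor_sum_unit N k).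
by apply: cmod2_varpi; have := hN (4 * N + 2)%N ltac:(lia).
Qed.

(** Write the difference as 2(h' - h)v' + 2h(v' - v). The first term is 0 modulo 2^(n+3); in the
    second, v' - v = v v' (u - u')/varpi, so it is 2^(n+3)/varpi times h v v' zeta 5^(k+1) o, which
    is 1 modulo varpi. *)
Lemma calL_diff (n q k : nat) : (1 <= n)%N -> odd q -> chi (-1) != (-1) ^+ k ->
  cmod (2%:R ^+ (n + 3)) (calL (2 ^ m) chi (k + 2 ^ n * q) - calL (2 ^ m) chi k)
    (2%:R ^+ (n + 3) / varpi).
Proof.
move=> n1 oq par; rewrite !calL_half_euler_L.
have hh := half_euler_L_cong n q k n1 par.
have hu := half_euler_L_unit k par.
have [u0 vI v1] := euler5_unit k; set k' := (k + _)%N in hh *.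
have [u0' vI' v1'] := euler5_unit k'.
have [o [oo ho]] := five_expn_odd n q oq.
have uE : euler5 k - euler5 k' = zeta * 5%:R ^+ k.+1 * (2%:R ^+ (n + 2) * o%:R).
  rewrite /euler5 -addSn exprD -[5%:R ^+ (_ * _)]natrX ho natrD natrM natrX; ring.
have w1 : cmod varpi (half_euler_L k * (varpi / euler5 k) * (varpi / euler5 k')
    * zeta * (5 ^ k.+1)%:R * o%:R) 1.
  apply: cmod_varpi_mul1 (cmod_varpi_odd _ oo).
  apply: cmod_varpi_mul1; last by apply: cmod_varpi_odd; rewrite oddX orbT.
  apply: cmod_varpi_mul1 (chi_mod_varpi 5 isT).
  by do 2![apply: cmod_varpi_mul1; last exact: cmod2_varpi].
have p0 := varpi_neq0.
have t0 : 2%:R ^+ (n + 2) != 0 :> algC by rewrite expf_neq0 // two_unit.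
have wE : half_euler_L k * (varpi / euler5 k) * (varpi / euler5 k')
    * zeta * (5 ^ k.+1)%:R * o%:R = half_euler_L k * varpi ^+ 2
    * ((euler5 k - euler5 k') / 2%:R ^+ (n + 2)) / (euler5 k * euler5 k').
  rewrite uE natrX; field; by rewrite t0 u0 u0'.
rewrite wE in w1.
have := two_integralD _ _ (two_integralM _ _ hh vI') w1.
rewrite /cmod; congr two_integral; rewrite (addnS n 2) [_ ^+ (n + 2).+1]exprS.
move: (2%:R ^+ (n + 2)) t0 => t t0.
move: (euler5 k) (euler5 k') (half_euler_L k) (half_euler_L k') u0 u0'.
move=> u u' h h' u0 u0'; field.
by rewrite t0 u0 u0' p0.
Qed.

(** As 1 - zeta^-1 = -varpi/zeta, the left side is 2^(n+3)/varpi times -zeta h_k v_k, which is 1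
    modulo varpi whatever k is. *)
Lemma calL_target (n k : nat) : chi (-1) != (-1) ^+ k ->
  cmod (2%:R ^+ (n + 3)) (2%:R ^+ (n + 2) / (1 - zeta^*) * calL (2 ^ m) chi k)
    (2%:R ^+ (n + 3) / varpi).
Proof.
move=> par; rewrite calL_half_euler_L conj_zeta.
have hu := half_euler_L_unit k par; have [u0 vI v1] := euler5_unit k.
have z0 := zeta_neq0; have p0 := varpi_neq0.
have m1 : cmod varpi (-1) 1.
  apply: cmod2_varpi; rewrite /cmod -opprD mulNr divff ?two_unit //.
  exact/two_integralN/(two_integral_nat 1).
have := cmod_varpi_mul1 _ _ m1 (cmod_varpi_mul1 _ _ (chi_mod_varpi 5 isT)
  (cmod_varpi_mul1 _ _ hu (cmod2_varpi _ _ v1))).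
have -> : 1 - zeta^-1 = - (varpi / zeta) by field.
rewrite /cmod; congr two_integral; rewrite (addnS n 2) exprS.
have t0 : 2%:R ^+ (n + 2) != 0 :> algC by rewrite expf_neq0 // two_unit.
move: (2%:R ^+ (n + 2)) t0 => t t0; field.
by rewrite t0 z0 p0 u0.
Qed.

Lemma two_power_val (x : nat) : (0 < x)%N -> exists a q, odd q /\ (x = 2 ^ a * q)%N.
Proof.
move=> x0; have [q oq xE] := pfactor_coprime (isT : prime 2) x0.
by exists (logn 2 x), q; rewrite -coprime2n mulnC.
Qed.

(** Write x = 2^a q with q odd; equal parities force a >= 1. By [calL_diff] the difference is
    2^(a+3)/varpi modulo 2^(a+3). If n <= a, it is divisible by 2^(a+2) since varpi divides 2; if a
    < n, the congruence would make 1/varpi integral. *)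
Lemma calL_cong_iff (n k x : nat) : (1 <= n)%N ->
  chi (-1) != (-1) ^+ k -> chi (-1) != (-1) ^+ (k + x) ->
  cmod (2%:R ^+ (n + 2)) (calL (2 ^ m) chi (k + x)) (calL (2 ^ m) chi k)
    <-> (2 ^ n %| x)%N.
Proof.
move=> n1 par parx; case: (posnP x) => [->|x0].
  by rewrite addn0 dvdn0; split=> // _; apply: cmod_refl.
have [a [q [oq xE]]] := two_power_val x x0.
have a1 : (1 <= a)%N.
  case: a xE => // xE; rewrite mul1n in xE; move: par parx.
  have : chi (-1) ^+ 2 == 1 by rewrite expr2 -chiM mulrNN mulr1 chi1.
  rewrite sqrf_eq1 -signr_odd -[_ ^+ (k + x)]signr_odd oddD xE oq.
  by case/orP=> /eqP->; case: (odd k); rewrite /= ?expr0 ?expr1 eqxx.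
have := calL_diff a q k a1 oq par; rewrite -xE => hd.
have dE : (2 ^ n %| x)%N = (n <= a)%N.
  by rewrite xE Gauss_dvdl ?coprimeXl ?coprime2n // dvdn_Pexp2l.
rewrite dE; split=> [hc|na].
  rewrite leqNgt; apply/negP => an; apply: varpi_not_unit.
  have {}hc := cmod_le (a + 3) (n + 2) _ _ ltac:(lia) hc.
  have := two_integralB _ _ hc hd; congr two_integral.
  have t0 : 2%:R ^+ (a + 3) != 0 :> algC by rewrite expf_neq0 // two_unit.
  have p0 := varpi_neq0.
  by move: (2%:R ^+ (a + 3)) t0 => t t0; field; rewrite t0 p0.
apply: (cmod_le _ (a + 2)); first by lia.
have := two_integralD _ _ (two_integralM _ _ hd (two_integral_nat 2)) two_div_varpi.
rewrite /cmod; congr two_integral; rewrite (addnS a 2) exprS.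
have t0 : 2%:R ^+ (a + 2) != 0 :> algC by rewrite expf_neq0 // two_unit.
have p0 := varpi_neq0.
by move: (2%:R ^+ (a + 2)) t0 => t t0; field; rewrite t0 p0.
Qed.

End TwoPowerConductor.
Theorem theorem1p1 (m : nat) (chi : int -> algC) (n : nat) :
  (3 <= m)%N -> primitive_dchar (2 ^ m) chi -> (1 <= n)%N ->
  (forall q k : nat, odd q -> (1 <= q)%N -> chi (-1) != (-1) ^+ k ->
     cong2 (calL (2 ^ m) chi (k + 2 ^ n * q) - calL (2 ^ m) chi k)
           (2%:R ^+ (n + 2) / (1 - (chi 5)^*) * calL (2 ^ m) chi (k %% 2))
           (n + 3))
  /\
  (forall k l : nat, chi (-1) != (-1) ^+ k -> chi (-1) != (-1) ^+ l ->
     (cong2 (calL (2 ^ m) chi k) (calL (2 ^ m) chi l) (n + 2)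
      <-> k = l %[mod 2 ^ n])).
Proof.
move=> m3 chiP n1; split=> [q k oq _ par|k l park parl].
  apply: cmod_trans (calL_diff m chi m3 chiP n q k n1 oq par) _.
  apply/cmod_sym/(calL_target m chi m3 chiP).
  by rewrite modn2 signr_odd.
(* Both sides of the equivalence are symmetric in k and l. *)
wlog kl : k l park parl / (k <= l)%N.
  move=> wl; case: (leqP k l) => [|/ltnW] kl; first exact: wl.
  have [h1 h2] := wl l k parl park kl.
  by split=> [/cmod_sym/h1 ->|/esym/h2/cmod_sym].
have := calL_cong_iff m chi m3 chiP n k (l - k) n1 park.
rewrite subnKC // => /(_ parl) [h1 h2]; split.
  by move=> /cmod_sym/h1; rewrite -eqn_mod_dvd // => /eqP.
by move=> e; apply/cmod_sym/h2; rewrite -eqn_mod_dvd // e.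
Qed.
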